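(* The set $\bigcup_{1\leq n<\omega}\mathrm{L}(2n+1)$ is $\mathfrak{c}$-lineable; that is, $\bigcup_{1\leq n<\omega}\mathrm{L}(2n+1)\cup\{0\}$ contains a linear subspace of $\ell_\infty$ of dimension $\mathfrak{c}$.
   Context: $\ell_\infty$ is the real Banach space of bounded real sequences $x=(x(n))_{n\in\omega}$, where $\omega=\{0,1,2,\dots\}$. $\mathfrak{c}$ is the cardinality of the continuum. For $x\in\ell_\infty$, a real $\eta$ is an accumulation point of $x$ if $\{n\in\omega: |x(n)-\eta|<\varepsilon\}$ is infinite for all $\varepsilon>0$; $\mathrm{L}_x$ denotes the set of accumulation points of $x$. For a cardinal $\kappa$, $\mathrm{L}(\kappa)=\{x\in\ell_\infty: |\mathrm{L}_x|=\kappa\}$. A subset $M$ of a vector space $X$ is $\kappa$-lineable, for a cardinal $\kappa$, if $M\cup\{0\}$ contains a linear subspace of $X$ of dimension $\kappa$. *)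

(* Defs.v *)
From HB Require Import structures.
From mathcomp Require Import all_boot all_order all_algebra.
From mathcomp Require Import all_classical all_reals all_analysis.

Set Implicit Arguments.
Unset Strict Implicit.
Unset Printing Implicit Defensive.

Import Order.TTheory GRing.Theory Num.Theory.
Import numFieldNormedType.Exports.

Local Open Scope classical_set_scope.
Local Open Scope ring_scope.

Definition bounded_seq (R : realType) : {pred nat -> R} :=
  [pred x : nat -> R | `[< bounded_fun x >]].

Lemma bounded_seqP (R : realType) (x : nat -> R) :
  x \in @bounded_seq R <-> exists M : R, forall n, `|x n| <= M.
Proof.
have -> : x \in @bounded_seq R = `[< bounded_fun x >] by [].
have PF : ProperFilter (globally [set: nat]).
  exact: (globally_properfilter (a := 0%N)).
rewrite asboolE /=; split=> [/ex_bound[M xM]|[M xM]].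
  by exists M => n; exact: xM.
by apply/ex_bound; exists M => n _; exact: xM.
Qed.

Lemma bounded_seq_submod_closed (R : realType) :
  submod_closed (@bounded_seq R).
Proof.
split; first by apply/bounded_seqP; exists 0 => n; rewrite normr0.
move=> a x y /bounded_seqP[M xM] /bounded_seqP[N yN].
apply/bounded_seqP; exists (`|a| * M + N) => n.
by rewrite (le_trans (ler_normD _ _))// lerD// normrM ler_wpM2l.
Qed.

HB.instance Definition _ (R : realType) :=
  GRing.isSubmodClosed.Build R (nat -> R) (@bounded_seq R)
    (@bounded_seq_submod_closed R).

(* The Banach space of bounded real sequences, with the pointwise vector space
   structure inherited from [nat -> R]; its norm is not needed here. *)
Record linfty (R : realType) := Linfty {
  linfty_val :> nat -> R;
  _ : linfty_val \in @bounded_seq R }.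

HB.instance Definition _ (R : realType) := [isSub for @linfty_val R].
HB.instance Definition _ (R : realType) := [Choice of linfty R by <:].
HB.instance Definition _ (R : realType) :=
  [SubChoice_isSubLmodule of linfty R by <:].

Section Lineability.
Context (K : fieldType) (V : lmodType K).

Definition linearly_independent (B : set V) :=
  forall (n : nat) (b : 'I_n -> V) (c : 'I_n -> K),
    injective b -> (forall i, B (b i)) ->
    \sum_(i < n) c i *: b i = 0 -> forall i, c i = 0.

Definition linear_span (B : set V) : set V :=
  [set v | exists n (b : 'I_n -> V) (c : 'I_n -> K),
     (forall i, B (b i)) /\ v = \sum_(i < n) c i *: b i].

Definition is_basis (W B : set V) :=
  linearly_independent B /\ linear_span B = W.

(* A cardinal is represented by a set [k] having that cardinality; all bases of
   [W] are equipotent, so the choice of [B] is immaterial. *)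
Definition has_dimension (U : Type) (W : set V) (k : set U) :=
  exists B : set V, is_basis W B /\ (B #= k)%card.

Definition lineable (U : Type) (k : set U) (M : set V) :=
  exists W : set V,
    [/\ submod_closed [in W], has_dimension W k & W `<=` M `|` [set 0]].

End Lineability.

Definition accumulation_points (R : realType) (x : nat -> R) : set R :=
  [set eta | forall e : R, 0 < e -> infinite_set [set n | `|x n - eta| < e]].

Definition Lset (R : realType) (U : Type) (k : set U) : set (linfty R) :=
  [set x | (accumulation_points x #= k)%card].

Arguments Lset R {U} k.

(* Main.v *)
(** A finite set of reals that is symmetric about [0], contains [0] and is not
    [{0}] has odd cardinality at least [3].  To each real [t] attach the set of
    pairs [(k, floor (k t))]; for distinct reals these sets are almost disjoint,
    because [floor (k t)] separates reals once [k] is large.  Let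
    [x_t], indexed by the triples [(k, m, e)] of a natural number and two
    integers, be the sign of [e] where [m = floor (k t)] and [0] elsewhere.  A linear
    combination of such sequences has finite range, changes sign under
    [e -> -e], and vanishes infinitely often, so its accumulation points form a finite
    symmetric set containing [0]; by almost disjointness they also contain each
    coefficient. *)

Require Import Defs.
From mathcomp Require Import finmap.
From mathcomp Require Import all_boot all_order all_algebra.
From mathcomp Require Import all_classical all_reals all_analysis.
From mathcomp Require Import lra.

Import Order.TTheory GRing.Theory Num.Theory.

Local Open Scope classical_set_scope.
Local Open Scope ring_scope.

(** * Cardinality of finite symmetric sets of reals *)

Lemma uniq_seq_card_eq {T : choiceType} (s : seq T) :
  uniq s -> ([set` s] #= `I_(size s))%card.
Proof.
move=> us; have -> : [set` s] = [set` seq_fset tt s].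
  by rewrite predeqE => x; rewrite /mkset seq_fsetE.
by apply/card_eq_fsetP; rewrite size_seq_fset undup_id.
Qed.

Lemma symmetric_finite_card_odd {R : realType} (A : set R) (a : R) :
  finite_set A -> (forall v, A v -> A (- v)) -> A 0 -> A a -> a != 0 ->
  exists2 n : nat, (1 <= n)%N & (A #= `I_(2 * n + 1))%card.
Proof.
move=> /finite_seqP[r defA] AN A0 Aa a0.
have Ar v : A v <-> v \in r by rewrite defA.
pose s : seq R := undup [seq v <- r | 0 < v].
have s_gt0 v : v \in s -> 0 < v by rewrite mem_undup mem_filter => /andP[].
have sE v : v \in s = (0 < v) && (v \in r) by rewrite mem_undup mem_filter.
have Ns v : (v \in map -%R s) = (- v \in s).
  by rewrite -{1}[v]opprK (mem_map oppr_inj).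
(* With [s] the positive elements, sign alone keeps the three blocks of [s'] disjoint. *)
pose s' := 0 :: s ++ map -%R s.
have us' : uniq s'.
  rewrite /s' /= mem_cat Ns oppr0 orbb cat_uniq undup_uniq (map_inj_uniq oppr_inj).
  rewrite undup_uniq andbT /= sE ltxx /=; apply/hasPn => v /=; rewrite Ns => /s_gt0.
  by rewrite oppr_gt0 => v0; apply/negP => /s_gt0; rewrite ltNge ltW.
exists (size s).
  have : `|a| \in s.
    rewrite sE normr_gt0 a0 /=; apply/Ar.
    by case: (ger0P a) => _; [|exact: AN].
  by case: s {s_gt0 sE Ns s' us'}.
have -> : A = [set` s'].
  apply/seteqP; split=> v /=.
    rewrite /s' inE mem_cat Ns !sE oppr_gt0 => Av.
    case: (ltgtP v 0) => //= v0; first by apply/Ar/AN.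
    by rewrite orbF; exact/Ar.
  rewrite /s' inE mem_cat Ns !sE => /orP[/eqP -> //|/orP[] /andP[_ /Ar //]].
  by move=> /AN; rewrite opprK.
have -> : (2 * size s + 1 = size s')%N.
  by rewrite /s' /= size_cat size_map addn1 mul2n addnn.
exact: uniq_seq_card_eq.
Qed.

(** * Accumulation points of sequences with finite range *)

Lemma finite_isolated {R : realType} (s : seq R) (v : R) :
  exists2 e : R, 0 < e & {in s, forall u, `|u - v| < e -> u = v}.
Proof.
elim: s => [|w s [e e0 IH]]; first by exists 1.
case: (eqVneq w v) => [->|wv].
  by exists e => // u; rewrite inE => /orP[/eqP|/IH].
exists (Num.min e `|w - v|).
  by rewrite lt_min e0 normr_gt0 subr_eq0.
move=> u; rewrite inE lt_min => /orP[/eqP ->|us]; first by rewrite ltxx andbF.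
by move=> /andP[ue _]; exact: IH.
Qed.

(** Finitely many values are isolated from [v], so terms close enough to [v] equal it. *)
Lemma accumulation_points_finite_range {R : realType} (x : nat -> R) :
  finite_set (range x) ->
  accumulation_points x = [set v | infinite_set (x @^-1` [set v])].
Proof.
move=> /finite_seqP[s sE]; apply/seteqP; split=> v /= xv.
  have [e e0 es] := finite_isolated s v.
  apply: sub_infinite_set (xv e e0) => n /= /es; apply.
  by have : range x (x n) by []; rewrite sE.
move=> e e0; apply: sub_infinite_set xv => n /= ->.
by rewrite subrr normr0.
Qed.

Lemma infinite_injective_image {T : Type} (f : nat -> T) (A : set T) (K : nat) :
  injective f -> (forall k, (K <= k)%N -> A (f k)) -> infinite_set A.
Proof.
move=> finj fA; apply: (@sub_infinite_set _ (range (fun k => f (K + k)%N))).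
  by move=> _ [k _ <-]; apply: fA; exact: leq_addr.
have ginj : injective (fun k => f (K + k)%N) by move=> i j /finj /addnI.
by have := inj_card_eq (A := setT) (in2W ginj); rewrite card_eq_le => /andP[_ /infiniteP].
Qed.

Lemma floor_scale_separates {R : realType} (s t : R) : s != t ->
  exists K : nat, forall k : nat, (K <= k)%N ->
    Num.floor (k%:R * s) != Num.floor (k%:R * t).
Proof.
move=> st; have d0 : 0 < `|s - t| by rewrite normr_gt0 subr_eq0.
(* From this threshold on, [k * |s - t|] is at least 1, whereas two reals with the same floor differ
   by less than 1. *)
exists (Num.bound `|s - t|^-1) => k Kk; apply/eqP => E.
have : 1 <= k%:R * `|s - t|.
  rewrite -ler_pdivrMr // div1r.
  have inv0 : 0 <= `|s - t|^-1 by rewrite invr_ge0 normr_ge0.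
  by rewrite (le_trans (ltW (archi_boundP inv0))) // ler_nat.
rewrite -[X in X * _](ger0_norm (ler0n _ _)) -normrM mulrBr leNgt => /negP; apply.
have := floor_itv (k%:R * s); have := floor_itv (k%:R * t); rewrite E.
set m := Num.floor _; rewrite intrD => /andP[a b] /andP[c d].
by rewrite ltr_norml; apply/andP; split; lra.
Qed.

(** * The almost disjoint family of sequences *)

Definition code := (nat * int * int)%type.

Definition code_of (k : nat) (m e : int) : nat := pickle ((k, m, e) : code).

Definition ad_fun {R : realType} (t : R) (p : code) : R :=
  if p.1.2 == Num.floor (p.1.1%:R * t) then Num.sg p.2%:~R else 0.

(* [pickle_inv], unlike [unpickle], is injective where it is defined; hence
   [e -> -e] acts on the indices as an involution. *)
Definition ad_seq {R : realType} (t : R) (n : nat) : R :=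
  oapp (ad_fun t) 0 (pickle_inv n : option code).

Lemma ad_seq_code {R : realType} (t : R) k m e :
  ad_seq t (code_of k m e) =
  (if m == Num.floor (k%:R * t) then Num.sg e%:~R else 0).
Proof. by rewrite /ad_seq /code_of pickleK_inv. Qed.

Lemma ad_seq_values {R : realType} (t : R) n :
  [\/ ad_seq t n = 0, ad_seq t n = 1 | ad_seq t n = - 1].
Proof.
rewrite /ad_seq; case: (pickle_inv n) => [[[k m] e]|] /=; last by constructor.
rewrite /ad_fun; case: ifP => _; last by constructor.
by case: sgrP; constructor.
Qed.

Lemma ad_seq_bounded {R : realType} (t : R) : ad_seq t \in @bounded_seq R.
Proof.
apply/bounded_seqP; exists 1 => n.
by case: (ad_seq_values t n) => ->; rewrite ?normrN ?normr0 ?normr1.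
Qed.

Definition ad_vec {R : realType} (t : R) : linfty R := Linfty (ad_seq_bounded t).

Lemma linfty_val_sum {R : realType} (n : nat) (c : 'I_n -> R)
    (b : 'I_n -> linfty R) k :
  linfty_val (\sum_(i < n) c i *: b i) k = \sum_(i < n) c i * b i k.
Proof.
have valE (u v : linfty R) (a : R) j : (a *: u + v) j = a * u j + v j.
  by rewrite -[LHS]/(\val (a *: u + v) j) linearP.
by elim/big_rec2: _ => // i r u _ <-; rewrite valE.
Qed.

(** * Linear combinations of the family *)

Section Combination.
Context {R : realType} (n : nat) (c t : 'I_n -> R).

Let x := linfty_val (\sum_(i < n) c i *: ad_vec (t i)).

Lemma combE k : x k = \sum_(i < n) c i * ad_seq (t i) k.
Proof. exact: linfty_val_sum. Qed.

Lemma comb_finite_range : finite_set (range x).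
Proof.
(* A digit [d] in ['I_3] encodes the value [d - 1], so [g] has a finite domain and reaches every
   value of [x]. *)
pose g (d : {ffun 'I_n -> 'I_3}) : R := \sum_(i < n) c i * ((d i)%:R - 1).
apply: (@sub_finite_set _ _ (range g)); last exact: finite_image.
move=> _ [k _ <-]; rewrite combE.
pose dg (v : R) : 'I_3 := if v == 0 then inord 1 else
  if v == 1 then inord 2 else ord0.
exists [ffun i => dg (ad_seq (t i) k)] => //.
apply: eq_bigr => i _; rewrite ffunE /dg; congr (_ * _).
case: (ad_seq_values (t i) k) => ->.
- by rewrite eqxx inordK // subrr.
- by rewrite oner_eq0 eqxx inordK //; lra.
- rewrite oppr_eq0 oner_eq0 ifF; first by rewrite sub0r.
  by apply/eqP; lra.
Qed.

Lemma comb_zero : accumulation_points x 0.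
Proof.
rewrite (accumulation_points_finite_range _ comb_finite_range) /=.
apply: (@infinite_injective_image _ (fun k => code_of k 0 0) _ 0).
  by move=> i j /(pcan_inj pickleK) [].
move=> k _ /=; rewrite combE big1 // => i _.
by rewrite ad_seq_code sgr0 if_same mulr0.
Qed.

Lemma comb_opp v : accumulation_points x v -> accumulation_points x (- v).
Proof.
rewrite (accumulation_points_finite_range _ comb_finite_range) /=.
(* Indices that code no triple are fixed; there every [ad_seq] is 0, so the sign change holds
   trivially. *)
pose flip (k : nat) : nat :=
  if (pickle_inv k : option code) is Some p then code_of p.1.1 p.1.2 (- p.2)
  else k.
have flipK : involutive flip.
  move=> k; rewrite /flip; case E: (pickle_inv k : option code) => [[[l m] e]|] /=.
    rewrite pickleK_inv /= opprK /code_of.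
    by have := @pickle_invK code k; rewrite E.
  by rewrite E.
have xflip k : x (flip k) = - x k.
  rewrite !combE -sumrN; apply: eq_bigr => i _; rewrite -mulrN; congr (_ * _).
  rewrite /flip {2}/ad_seq.
  case E: (pickle_inv k : option code) => [[[l m] e]|] /=.
    by rewrite ad_seq_code /ad_fun /= mulrNz sgrN; case: ifP; rewrite ?oppr0.
  by rewrite /ad_seq E oppr0.
apply: contra_not => finN.
have := @finite_preimage _ _ _ flip (in2W (inv_inj flipK)) finN.
by apply: sub_finite_set => k /= kv; rewrite xflip kv.
Qed.

(** For large [k], this index meets only the sequences with parameter [t i]. Since [t] may repeat
    values, their coefficients add up. *)
Lemma comb_eval (i : 'I_n) : exists K, forall k, (K <= k)%N ->
  x (code_of k (Num.floor (k%:R * t i)) 1) = \sum_(j < n | t j == t i) c j.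
Proof.
have /choice[N NP] : forall j, exists K, forall k, (K <= k)%N -> t j != t i ->
    Num.floor (k%:R * t j) != Num.floor (k%:R * t i).
  move=> j; case: (eqVneq (t j) (t i)) => [_|/floor_scale_separates[K KP]].
    by exists 0%N.
  by exists K => k /KP.
exists (\max_j N j) => k Kk; rewrite combE [RHS]big_mkcond.
apply: eq_bigr => j _; rewrite ad_seq_code sgr1 eq_sym.
case: (eqVneq (t j) (t i)) => [->|tji]; first by rewrite eqxx mulr1.
by rewrite ifN ?mulr0 // NP // (leq_trans _ Kk) // leq_bigmax.
Qed.

Lemma comb_accumulation (i : 'I_n) :
  accumulation_points x (\sum_(j < n | t j == t i) c j).
Proof.
rewrite (accumulation_points_finite_range _ comb_finite_range) /=.
have [K KP] := comb_eval i.
apply: (@infinite_injective_image _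
  (fun k => code_of k (Num.floor (k%:R * t i)) 1) _ K); last exact: KP.
by move=> k l /(pcan_inj pickleK) [].
Qed.

(** Grouping the indices by the value of [t] leaves, for each value, one vector scaled by its total
    coefficient. *)
Lemma comb_eq0 : (forall i, \sum_(j < n | t j == t i) c j = 0) ->
  \sum_(i < n) c i *: ad_vec (t i) = 0.
Proof.
move=> c0; pose r i : seq_sub (codom t) := SeqSub (codom_f t i).
rewrite (partition_big r predT) //= big1 // => u _.
have /codomP[i ui] := valP u.
rewrite (eq_big (fun j => t j == t i) (fun j => c j *: ad_vec (t i))).
- by rewrite -scaler_suml c0 scale0r.
- by move=> j; rewrite -val_eqE /= ui.
- by move=> j; rewrite -val_eqE /= ui => /eqP ->.
Qed.

Lemma comb_odd_accumulation : \sum_(i < n) c i *: ad_vec (t i) != 0 ->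
  exists2 m : nat, (1 <= m)%N & (accumulation_points x #= `I_(2 * m + 1))%card.
Proof.
move=> x0; have [i ci] : exists i, \sum_(j < n | t j == t i) c j != 0.
  (* If all grouped coefficients vanished, so would the combination; a nonzero one is a nonzero
     accumulation point. *)
  apply: contra_neqP x0 => /forallNP ci; apply: comb_eq0 => i.
  by apply/eqP; apply: contra_notT (ci i).
apply: symmetric_finite_card_odd comb_opp comb_zero (comb_accumulation i) ci.
rewrite (accumulation_points_finite_range _ comb_finite_range).
apply: sub_finite_set comb_finite_range => v /= /infinite_setN0[k <-].
by exists k.
Qed.

End Combination.

(** * Independence and the spanned subspace *)

Lemma ad_vec_independent {R : realType} :
  linearly_independent (range (@ad_vec R)).
Proof.
move=> n b c binj bB c0 i.
have /choice[t tb] : forall j, exists s, b j = ad_vec s.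
  by move=> j; have [s _ <-] := bB j; exists s.
have [K /(_ K (leqnn K))] := comb_eval _ c t i.
under [X in linfty_val X]eq_bigr do rewrite -tb.
(* Injectivity of [b] makes [t] injective, so the group of [i] is a singleton and evaluation at one
   index isolates [c i]. *)
rewrite c0 (big_pred1 i) => [<- //|j].
by apply/eqP/eqP => [E|-> //]; apply: binj; rewrite !tb E.
Qed.

Lemma ad_vec_inj {R : realType} : injective (@ad_vec R).
Proof.
move=> s t E; apply/eqP; apply: contraT => /floor_scale_separates[K].
move=> /(_ K (leqnn K)) st.
(* At this index the sequence of [s] is 1 and that of [t] is 0. *)
have := congr1 (fun x : linfty R => x (code_of K (Num.floor (K%:R * s)) 1)) E.
rewrite /= !ad_seq_code eqxx (negbTE st) sgr1 => /eqP.
by rewrite oner_eq0.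
Qed.

Lemma linear_span_submod_closed {K : fieldType} {V : lmodType K} (B : set V) :
  submod_closed [in linear_span B].
Proof.
split.
  rewrite inE; exists 0%N, (fun=> 0), (fun=> 0); split; first by case.
  by rewrite big_ord0.
move=> a u v; rewrite !inE => -[n [b [c [bB ->]]]] [m [b' [c' [bB' ->]]]].
exists (n + m)%N,
  (fun i => match fintype.split i with inl j => b j | inr j => b' j end),
  (fun i => match fintype.split i with inl j => a * c j | inr j => c' j end).
split; first by move=> i; case: (fintype.split i).
rewrite big_split_ord /= scaler_sumr; congr (_ + _); apply: eq_bigr => i _.
  by rewrite (unsplitK (inl i)) scalerA.
by rewrite (unsplitK (inr i)).
Qed.

Theorem theorem5p9 (R : realType) :
  lineable [set: R]
    (\bigcup_(n in [set n : nat | (1 <= n)%N]) Lset R `I_(2 * n + 1)).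
Proof.
exists (linear_span (range (@ad_vec R))); split.
- exact: linear_span_submod_closed.
- exists (range (@ad_vec R)); split; first by split=> //; exact: ad_vec_independent.
  by apply: inj_card_eq => s t _ _; exact: ad_vec_inj.
move=> _ [n [b [c [bB ->]]]].
have /choice[t tb] : forall j, exists s, b j = ad_vec s.
  by move=> j; have [s _ <-] := bB j; exists s.
under eq_bigr do rewrite tb.
case: (eqVneq (\sum_(i < n) c i *: ad_vec (t i)) 0) => [->|x0]; first by right.
by left; have [m m1 xm] := comb_odd_accumulation _ _ _ x0; exists m.
Qed.
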